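(* Let $L,M\ge1$. Let $B\in\{1,\dots,L\}$ be the oracle label with prior probabilities $\rho_j=\mathbb{P}(B=j)$, and let $D=(D_1,\dots,D_M)\in\{1,\dots,L\}^M$ be local recommendations that are conditionally independent given $B$ with channels $Q_m(a\mid j)=\mathbb{P}(D_m=a\mid B=j)$, that is, $P_j(d):=\mathbb{P}(D=d\mid B=j)=\prod_{m=1}^M Q_m(d_m\mid j)$. Let $\delta_{\mathrm{MAP}}(d)=\arg\max_{1\le j\le L}\rho_jP_j(d)$ be the maximum a posteriori fusion rule, and for $i\ne j$ and $0\le s\le1$ let $$c_{m,ij}(s)=\sum_{a=1}^L Q_m(a\mid j)^{1-s}\,Q_m(a\mid i)^{s}.$$ Then $$\mathbb{P}\{\delta_{\mathrm{MAP}}(D)\ne B\}\le\sum_{j=1}^L\sum_{\substack{i=1\\ i\ne j}}^L\ \inf_{0\le s\le1}\ \rho_j^{1-s}\rho_i^{s}\prod_{m=1}^M c_{m,ij}(s).$$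
   Context: $B=j$ means that experiment $\xi_j$, among finitely many candidates $\xi_1,\dots,\xi_L$, is the one a centralized oracle would select; $D_m$ is the index of the experiment recommended by agent $m$. We have $\rho_j\ge0$, $\sum_{j=1}^L\rho_j=1$, and for each $m$ and $j$, $Q_m(a\mid j)\ge0$, $\sum_{a=1}^L Q_m(a\mid j)=1$; the joint law is $\mathbb{P}(B=j,D=d)=\rho_j\prod_{m=1}^M Q_m(d_m\mid j)$. Ties in the argmax defining $\delta_{\mathrm{MAP}}$ are broken by any deterministic rule. The convention $0^0=1$ is used. The quantity $c_{m,ij}(s)$ is the site-level pairwise Chernoff coefficient. *)

(* Defs.v *)
From mathcomp Require Import all_boot all_order all_algebra.
From mathcomp Require Import all_classical all_reals all_analysis.

Set Implicit Arguments.
Unset Strict Implicit.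
Unset Printing Implicit Defensive.
Import Order.TTheory GRing.Theory Num.Theory.
Local Open Scope classical_set_scope.
Local Open Scope ring_scope.

(* Random variable in 'I_n, for the discrete sigma-algebra; the library's {RV _}
   needs a pointed codomain, which 'I_n is not for a variable n. *)
Definition label_rv {d0 : measure_display} {T : measurableType d0} {n : nat}
    (X : T -> 'I_n) : Prop :=
  forall A : set 'I_n, measurable (X @^-1` A).

Section Fusion.
Context {R : realType} {L M : nat}.
(* A channel family is written [Q m a j] for Q_m(a | j): output before input. *)
Implicit Types (rho : 'I_L -> R) (Q : 'I_M -> 'I_L -> 'I_L -> R).
Implicit Types (delta : {ffun 'I_M -> 'I_L} -> 'I_L).

Definition is_prior rho : Prop :=
  (forall j, 0 <= rho j) /\ \sum_(j < L) rho j = 1.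

Definition is_channel_family Q : Prop :=
  forall m j, (forall a, 0 <= Q m a j) /\ \sum_(a < L) Q m a j = 1.

Definition likelihood Q (j : 'I_L) (d : {ffun 'I_M -> 'I_L}) : R :=
  \prod_(m < M) Q m (d m) j.

(* Conditional independence of the D_m given B with channels Q_m, in joint-law
   form, so that labels of prior probability zero need no separate treatment. *)
Definition has_joint_law {d0 : measure_display} {T : measurableType d0}
    (P : probability T R) (B : T -> 'I_L) (D : 'I_M -> T -> 'I_L) rho Q : Prop :=
  forall (j : 'I_L) (d : {ffun 'I_M -> 'I_L}),
    P [set w | B w = j /\ forall m, D m w = d m]
    = (rho j * likelihood Q j d)%:E.

(* Any selection of a maximizer, i.e. an arbitrary deterministic tie-breaking. *)
Definition is_MAP rho Q delta : Prop :=
  forall d j, rho j * likelihood Q j d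
              <= rho (delta d) * likelihood Q (delta d) d.

(* c_{m,ij}(s); [powR] satisfies 0 `^ 0 = 1 and 0 `^ s = 0 for s != 0. *)
Definition chernoff_coef Q (m : 'I_M) (i j : 'I_L) (s : R) : R :=
  \sum_(a < L) (Q m a j) `^ (1 - s) * (Q m a i) `^ s.

End Fusion.

(* Main.v *)
(** The error event splits into the disjoint events [B = j, D = d] with
    [delta d = i != j].  On such a [d] the MAP rule gives
    [rho_j P_j(d) <= rho_i P_i(d)], hence
    [rho_j P_j(d) <= (rho_j P_j(d))^(1-s) (rho_i P_i(d))^s] for every [s] in
    [[0, 1]].  Enlarging the sum to all [d], it factorizes over the sites. *)
Require Import Defs.
From mathcomp Require Import all_boot all_order all_algebra.
From mathcomp Require Import all_classical all_reals all_analysis.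

Set Implicit Arguments.
Unset Strict Implicit.
Unset Printing Implicit Defensive.
Import Order.TTheory GRing.Theory Num.Theory.
Local Open Scope classical_set_scope.
Local Open Scope ring_scope.

(** Write [x] as [x^(1-s) * x^s] and enlarge only the second factor, by monotonicity of the power
    [s]. *)
Lemma ler_powR_geomean (R : realType) (x y s : R) :
  0 <= x -> x <= y -> 0 <= s -> x <= x `^ (1 - s) * y `^ s.
Proof.
move=> x0 xy s0; have y0 := le_trans x0 xy.
apply: (@le_trans _ _ (x `^ (1 - s) * x `^ s)).
  (* The exponents add up to 1, which is nonzero, so they may be split even when [x = 0]. *)
  by rewrite -powRD subrK ?powRr1// oner_eq0.
by rewrite ler_wpM2l ?powR_ge0// ge0_ler_powR// nnegrE.
Qed.

Lemma powR_prod (R : realType) (I : finType) (F : I -> R) (s : R) :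
  (forall i, 0 <= F i) -> (\prod_i F i) `^ s = \prod_i F i `^ s.
Proof.
(* Nonnegativity is carried through the induction because [powRM] asks for it on both factors,
   partial products included. *)
move=> F0; suff [] : 0 <= \prod_i F i /\ (\prod_i F i) `^ s = \prod_i F i `^ s.
  by [].
apply: (big_ind2 (fun x y => 0 <= x /\ x `^ s = y)) => // [|x _ y _ [x0 <-] [y0 <-]].
  by rewrite powR1.
by rewrite mulr_ge0// powRM.
Qed.

(** Distributivity: expanding the product over sites of sums over labels gives one term for each
    choice of a label at every site, that is, for each vector [d]. *)
Lemma sum_chernoff_factorization (R : realType) (L M : nat)
    (rho : 'I_L -> R) (Q : 'I_M -> 'I_L -> 'I_L -> R) (i j : 'I_L) (s : R) :
  (forall k, 0 <= rho k) -> (forall m a k, 0 <= Q m a k) ->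
  \sum_d (rho j * likelihood Q j d) `^ (1 - s)
         * (rho i * likelihood Q i d) `^ s
  = rho j `^ (1 - s) * rho i `^ s * \prod_(m < M) chernoff_coef Q m i j s.
Proof.
move=> rho0 Q0; rewrite bigA_distr_bigA big_distrr; apply: eq_bigr => d _ /=.
rewrite !powRM ?prodr_ge0// /likelihood !powR_prod// mulrACA; congr (_ * _).
by rewrite -big_split.
Qed.

Lemma pairwise_chernoff_bound (R : realType) (L M : nat)
    (rho : 'I_L -> R) (Q : 'I_M -> 'I_L -> 'I_L -> R)
    (delta : {ffun 'I_M -> 'I_L} -> 'I_L) (i j : 'I_L) :
  (forall k, 0 <= rho k) -> (forall m a k, 0 <= Q m a k) ->
  is_MAP rho Q delta ->
  \sum_(d | delta d == i) rho j * likelihood Q j d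
  <= inf [set rho j `^ (1 - s) * rho i `^ s
                * \prod_(m < M) chernoff_coef Q m i j s | s in `[0, 1]].
Proof.
move=> rho0 Q0 hdelta; apply: lb_le_inf.
  (* An infimum is bounded below by a lower bound only for a nonempty set; [s = 0] provides a
     point. *)
  by eexists; exists 0 => //=; rewrite in_itv/= lexx ler01.
move=> _ [s /= /[!in_itv]/= /andP[s0 s1] <-].
rewrite -sum_chernoff_factorization// big_mkcond/=.
(* Where [delta d = i], the MAP inequality against [j] feeds the geometric-mean bound; every other
   [d] adds a nonnegative term on the right against 0 on the left. *)
apply: ler_sum => d _; case: eqP => [<-|_]; last by rewrite mulr_ge0 ?powR_ge0.
by rewrite ler_powR_geomean// mulr_ge0// prodr_ge0.
Qed.

Lemma measurable_joint_event (L M : nat) (d0 : measure_display)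
    (T : measurableType d0) (B : T -> 'I_L) (D : 'I_M -> T -> 'I_L)
    (j : 'I_L) (d : {ffun 'I_M -> 'I_L}) :
  label_rv B -> (forall m, label_rv (D m)) ->
  measurable [set w | B w = j /\ forall m, D m w = d m].
Proof.
move=> hB hD; rewrite [X in measurable X](_ : _ =
    B @^-1` [set j] `&` \bigcap_m (D m @^-1` [set d m])).
  apply: measurableI; first exact: hB.
  by apply: fin_bigcap_measurable => // m _; exact: hD.
by apply/seteqP; split=> w /= [Bj Dd]; split=> // m; [move=> _|]; exact: Dd.
Qed.

Lemma MAP_error_probability (R : realType) (L M : nat)
    (d0 : measure_display) (T : measurableType d0) (P : probability T R)
    (B : T -> 'I_L) (D : 'I_M -> T -> 'I_L)
    (rho : 'I_L -> R) (Q : 'I_M -> 'I_L -> 'I_L -> R)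
    (delta : {ffun 'I_M -> 'I_L} -> 'I_L) :
  label_rv B -> (forall m, label_rv (D m)) -> has_joint_law P B D rho Q ->
  P [set w | delta [ffun m => D m w] <> B w]
  = (\sum_(j < L) \sum_(d | delta d != j) rho j * likelihood Q j d)%:E.
Proof.
move=> hB hD hlaw.
(* The atoms of the joint law, indexed by the finitely many pairs of a label and a recommendation
   vector. *)
pose E (p : 'I_L * {ffun 'I_M -> 'I_L}) :=
  [set w | B w = p.1 /\ forall m, D m w = p.2 m].
rewrite [X in P X](_ : _ = \bigcup_(p in [set p | delta p.2 != p.1]) E p); last first.
  apply/seteqP; split=> w /=.
    move=> /eqP dB; exists (B w, [ffun m => D m w]) => //=.
    by split=> // m /=; rewrite ffunE.
  move=> [[j d]/= /eqP dj [/= -> Dd]].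
  by rewrite (_ : finfun _ = d)//; apply/ffunP => m; rewrite ffunE.
rewrite measure_fin_bigcup//; last first.
- by move=> p _; exact: measurable_joint_event.
(* Disjointness: an outcome [w] lying in two atoms determines both indices. *)
- move=> [j d] [k e] _ _ [w [[/= <- Dd] [/= <- De]]].
  by congr pair; apply/ffunP => m; rewrite -Dd -De.
- exact: finite_finset.
(* Both sides become sums over the enumeration of all pairs, to be compared atom by atom. *)
rewrite pair_big_dep/= -(bigfs _ (r := index_enum _)) ?index_enum_uniq//; last first.
  by move=> p _; rewrite mem_index_enum.
by rewrite -sumEFin; apply: eq_bigr => p _; exact: hlaw.
Qed.

Theorem theorem3 (R : realType) (L M : nat) (hL : (1 <= L)%N) (hM : (1 <= M)%N)
    (d0 : measure_display) (T : measurableType d0) (P : probability T R)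
    (B : T -> 'I_L) (D : 'I_M -> T -> 'I_L)
    (hBrv : label_rv B) (hDrv : forall m : 'I_M, label_rv (D m))
    (rho : 'I_L -> R) (Q : 'I_M -> 'I_L -> 'I_L -> R)
    (hrho : is_prior rho)
    (hB : forall j : 'I_L, P [set w | B w = j] = (rho j)%:E)
    (hQ : is_channel_family Q)
    (hlaw : has_joint_law P B D rho Q)
    (delta : {ffun 'I_M -> 'I_L} -> 'I_L)
    (hdelta : is_MAP rho Q delta) :
  (P [set w | delta [ffun m => D m w] <> B w]
   <= (\sum_(j < L) \sum_(i < L | i != j)
         inf [set rho j `^ (1 - s) * rho i `^ s
                  * \prod_(m < M) chernoff_coef Q m i j s
             | s in `[0, 1]])%:E)%E.
Proof.
have rho0 := hrho.1; have Q0 m a k : 0 <= Q m a k by case: (hQ m k).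
rewrite (MAP_error_probability delta hBrv hDrv hlaw) lee_fin.
apply: ler_sum => j _.
(* The errors under label [j] are grouped by the wrong label [i] that [delta] outputs; given
   [i != j], the condition [delta d = i] already implies an error. *)
rewrite (partition_big delta (fun i => i != j))//=; apply: ler_sum => i ij.
rewrite (eq_bigl (fun d => delta d == i)); first exact: pairwise_chernoff_bound.
by move=> d; rewrite andb_idl// => /eqP ->.
Qed.
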